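(* Let $\alpha>0$ be a constant, let $g_1=v^{-4}g_s$ be a metric on $S^1$ with $v\in C^2(S^1)$, $v>0$, and let $\varphi\in C^2(S^1)$ with $\varphi>0$. If $g_2=\varphi^{-4}g_1$, then $$R^\alpha_{g_2}=\varphi^3L^\alpha_{g_1}\varphi,$$ and $$L^\alpha_{g_2}(\psi)=\varphi^3L^\alpha_{g_1}(\psi\varphi)\qquad\text{for all }\psi\in C^2(S^1).$$
   Context: $S^1$ is the unit circle with angle $\theta$ and standard metric $g_s=d\theta\otimes d\theta$; functions on $S^1$ are $2\pi$-periodic functions of $\theta$. For a metric $g=d\sigma\otimes d\sigma=v^{-4}g_s$ with $v>0$ (so $d\sigma=v^{-2}d\theta$), put $\nabla_g=D_\sigma=v^2\frac{d}{d\theta}$ and $\Delta_g=D_{\sigma\sigma}=v^2\frac{d}{d\theta}\big(v^2\frac{d}{d\theta}\,\cdot\,\big)$. For a constant $\alpha>0$, the $\alpha$-scalar curvature of $g$ is $$R^\alpha_g=v^3(\alpha v_{\theta\theta}+v),$$ and the $\alpha$-conformal Laplace–Beltrami operator of $g$ is $L^\alpha_g=\alpha\Delta_g+R^\alpha_g$, i.e. $L^\alpha_g f=\alpha\Delta_gf+R^\alpha_gf$. *)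

(* Defs.v *)
From Stdlib Require Import Reals Lra.
From Coquelicot Require Import Coquelicot.
Open Scope R_scope.

(* A function on the unit circle is a 2 pi - periodic function of the angle. *)
Definition circle_fun (f : R -> R) : Prop :=
  forall theta : R, f (theta + 2 * PI) = f theta.

(* [Derive] is total, so the existence of each derivative is required
   separately. *)
Definition C2_circle (f : R -> R) : Prop :=
  circle_fun f /\
  (forall theta : R, ex_derive f theta) /\
  (forall theta : R, ex_derive (Derive f) theta) /\
  (forall theta : R, continuous (Derive (Derive f)) theta).

(* The metric g(theta) dtheta (x) dtheta, given by its coefficient g. *)
Record metric : Type := Metric {
  coef :> R -> R;
  coef_circle : circle_fun coef;
  coef_pos : forall theta : R, 0 < coef theta
}.

Definition g_s : metric :=
  Metric (fun _ : R => 1) (fun _ : R => eq_refl) (fun _ : R => Rlt_0_1).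

(* g' = u^{-4} g. *)
Definition conformal (u : R -> R) (g g' : metric) : Prop :=
  forall theta : R, g' theta = / (u theta) ^ 4 * g theta.

(* The unique positive v with g = v^{-4} g_s, namely the coefficient of g to
   the power -1/4; see [conformal_factorP] and [conformal_factor_unique]. *)
Definition conformal_factor (g : metric) (theta : R) : R :=
  / sqrt (sqrt (g theta)).

(* D_sigma, where dsigma = v^{-2} dtheta. *)
Definition grad (g : metric) (f : R -> R) (theta : R) : R :=
  (conformal_factor g theta) ^ 2 * Derive f theta.

Definition laplacian (g : metric) (f : R -> R) : R -> R := grad g (grad g f).

Definition scalar_curvature (alpha : R) (g : metric) (theta : R) : R :=
  let v := conformal_factor g in
  (v theta) ^ 3 * (alpha * Derive (Derive v) theta + v theta).

Definition conformal_laplacian (alpha : R) (g : metric) (f : R -> R)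
    (theta : R) : R :=
  alpha * laplacian g f theta + scalar_curvature alpha g theta * f theta.

Lemma conformal_factor_pos (g : metric) (theta : R) :
  0 < conformal_factor g theta.
Proof.
apply Rinv_0_lt_compat, sqrt_lt_R0, sqrt_lt_R0, coef_pos.
Qed.

Lemma conformal_factorP (g : metric) : conformal (conformal_factor g) g_s g.
Proof.
intros t; unfold conformal_factor; simpl coef.
pose proof (coef_pos g t) as Hg.
rewrite pow_inv, Rinv_inv, Rmult_1_r.
replace (sqrt (sqrt (g t)) ^ 4) with ((sqrt (sqrt (g t)) ^ 2) ^ 2) by ring.
rewrite pow2_sqrt by apply sqrt_pos.
rewrite pow2_sqrt; lra.
Qed.

Lemma conformal_factor_unique (v : R -> R) (g : metric) :
  (forall theta : R, 0 < v theta) -> conformal v g_s g ->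
  forall theta : R, conformal_factor g theta = v theta.
Proof.
intros Hv Hg t; unfold conformal_factor; rewrite Hg; simpl coef.
pose proof (Hv t) as Hvt.
assert (Hi : 0 < / v t) by now apply Rinv_0_lt_compat.
rewrite Rmult_1_r, <- pow_inv.
replace ((/ v t) ^ 4) with (((/ v t) ^ 2) ^ 2) by ring.
rewrite sqrt_pow2 by (apply pow_le; lra).
rewrite sqrt_pow2 by lra.
apply Rinv_inv.
Qed.

Lemma conformal_exists (u : R -> R) (g : metric) :
  circle_fun u -> (forall theta : R, 0 < u theta) ->
  exists g' : metric, conformal u g g'.
Proof.
intros Hc Hu.
assert (Hc' : circle_fun (fun t => / (u t) ^ 4 * g t))
  by (intros t; now rewrite Hc, (coef_circle g)).
assert (Hp : forall t, 0 < / (u t) ^ 4 * g t)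
  by (intros t; apply Rmult_lt_0_compat;
      [apply Rinv_0_lt_compat, pow_lt, Hu | apply coef_pos]).
now exists (Metric _ Hc' Hp).
Qed.

(* Main.v *)
(** With respect to [g_s] the conformal factor of [g2] is [v * phi]; both
    identities then follow by expanding the first two derivatives of the
    products [v * phi] and [psi * phi] and comparing polynomials. *)

Require Import Defs.
From Stdlib Require Import Reals.
From Coquelicot Require Import Coquelicot.
Open Scope R_scope.

(** Naming the derivatives as functions lets [Derive], which is total, be replaced by explicit
    expressions on which [ring] can work. *)
Definition has_derivatives2 (f f1 f2 : R -> R) : Prop :=
  (forall t : R, is_derive f t (f1 t)) /\ (forall t : R, is_derive f1 t (f2 t)).

Lemma C2_circle_derivatives2 (f : R -> R) :
  C2_circle f -> has_derivatives2 f (Derive f) (Derive (Derive f)).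
Proof.
intros (_ & Hf & Hf' & _); split; intros t; now apply Derive_correct.
Qed.

Lemma has_derivatives2_mult (f f1 f2 g g1 g2 : R -> R) :
  has_derivatives2 f f1 f2 -> has_derivatives2 g g1 g2 ->
  has_derivatives2 (fun t => f t * g t) (fun t => f1 t * g t + f t * g1 t)
    (fun t => f2 t * g t + 2 * f1 t * g1 t + f t * g2 t).
Proof.
intros [Hf Hf1] [Hg Hg1]; split; intros t.
(* [is_derive_mult] is stated over an arbitrary ring with absolute value, hence the extra
   commutativity premise. *)
- apply (is_derive_mult f g t (f1 t) (g1 t)); auto using Rmult_comm.
- replace (f2 t * g t + 2 * f1 t * g1 t + f t * g2 t)
    with ((f2 t * g t + f1 t * g1 t) + (f1 t * g1 t + f t * g2 t)) by ring.
  apply (is_derive_plus (fun s => f1 s * g s) (fun s => f s * g1 s)).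
  + apply (is_derive_mult f1 g t (f2 t) (g1 t)); auto using Rmult_comm.
  + apply (is_derive_mult f g1 t (f1 t) (g2 t)); auto using Rmult_comm.
Qed.

Lemma has_derivatives2_Derive (f f1 f2 : R -> R) :
  has_derivatives2 f f1 f2 ->
  forall t : R, Derive f t = f1 t /\ Derive (Derive f) t = f2 t.
Proof.
intros [Hf Hf1] t; split.
- now apply is_derive_unique.
- rewrite (Derive_ext _ f1) by (intros s; now apply is_derive_unique).
  now apply is_derive_unique.
Qed.

Lemma scalar_curvatureE (alpha : R) (g : metric) (u u1 u2 : R -> R) :
  (forall t : R, conformal_factor g t = u t) -> has_derivatives2 u u1 u2 ->
  forall t : R,
    scalar_curvature alpha g t = u t ^ 3 * (alpha * u2 t + u t).
Proof.
intros Hg Hu t; unfold scalar_curvature.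
(* The factor is known only pointwise, so the equality is carried through each [Derive] in turn. *)
rewrite (Derive_ext _ (Derive u)) by (intros s; now apply Derive_ext).
now rewrite Hg, (proj2 (has_derivatives2_Derive _ _ _ Hu t)).
Qed.

(** Since [grad g f] equals [u^2 * f1], this is one more product rule. Together with
    [scalar_curvatureE] it turns the operator into a polynomial in [alpha] and the derivatives of
    [u] and [f]. *)
Lemma laplacianE (g : metric) (u u1 u2 f f1 f2 : R -> R) :
  (forall t : R, conformal_factor g t = u t) ->
  has_derivatives2 u u1 u2 -> has_derivatives2 f f1 f2 ->
  forall t : R,
    laplacian g f t = u t ^ 2 * (2 * u t * u1 t * f1 t + u t ^ 2 * f2 t).
Proof.
intros Hg [Hu _] [Hf Hf1] t; unfold laplacian, grad.
(* The square is written as a product so that [is_derive_mult] applies twice. *)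
rewrite (Derive_ext _ (fun s => (u s * u s) * f1 s)).
2: { intros s; rewrite Hg, (is_derive_unique _ _ _ (Hf s)); ring. }
rewrite Hg; f_equal; apply is_derive_unique.
replace (2 * u t * u1 t * f1 t + u t ^ 2 * f2 t)
  with ((u1 t * u t + u t * u1 t) * f1 t + (u t * u t) * f2 t) by ring.
apply (is_derive_mult (fun s => u s * u s) f1 t);
  [| apply Hf1 | apply Rmult_comm].
apply (is_derive_mult u u t); auto using Rmult_comm.
Qed.

Lemma conformal_trans (u w : R -> R) (g0 g1 g2 : metric) :
  conformal u g0 g1 -> conformal w g1 g2 ->
  conformal (fun t => u t * w t) g0 g2.
Proof.
intros H1 H2 t; rewrite H2, H1, Rpow_mult_distr, Rinv_mult; ring.
Qed.

Theorem proposition1 (alpha : R) (v phi : R -> R) (g1 g2 : metric)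
    (halpha : 0 < alpha)
    (hv : C2_circle v) (hv_pos : forall theta : R, 0 < v theta)
    (hg1 : conformal v g_s g1)
    (hphi : C2_circle phi) (hphi_pos : forall theta : R, 0 < phi theta)
    (hg2 : conformal phi g1 g2) :
  (forall theta : R,
     scalar_curvature alpha g2 theta =
     (phi theta) ^ 3 * conformal_laplacian alpha g1 phi theta) /\
  (forall psi : R -> R, C2_circle psi ->
   forall theta : R,
     conformal_laplacian alpha g2 psi theta =
     (phi theta) ^ 3 *
       conformal_laplacian alpha g1 (fun t : R => psi t * phi t) theta).
Proof.
pose proof (conformal_factor_unique _ _ hv_pos hg1) as F1.
assert (F2 : forall t, conformal_factor g2 t = v t * phi t).
{ apply conformal_factor_unique.
  - intros t; now apply Rmult_lt_0_compat.
  - exact (conformal_trans _ _ _ _ _ hg1 hg2). }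
apply C2_circle_derivatives2 in hv, hphi.
pose proof (has_derivatives2_mult _ _ _ _ _ _ hv hphi) as hw.
split.
- intros t; unfold conformal_laplacian.
  rewrite (scalar_curvatureE _ _ _ _ _ F2 hw),
    (scalar_curvatureE _ _ _ _ _ F1 hv),
    (laplacianE _ _ _ _ _ _ _ F1 hv hphi).
  (* Both sides are [(v phi)^3 (alpha (v phi)'' + v phi)]. *)
  ring.
- intros psi hpsi t; unfold conformal_laplacian.
  apply C2_circle_derivatives2 in hpsi.
  rewrite (scalar_curvatureE _ _ _ _ _ F2 hw),
    (scalar_curvatureE _ _ _ _ _ F1 hv),
    (laplacianE _ _ _ _ _ _ _ F2 hw hpsi),
    (laplacianE _ _ _ _ _ _ _ F1 hv
       (has_derivatives2_mult _ _ _ _ _ _ hpsi hphi)).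
  (* For a metric with factor [u], the operator sends [f] to [u^3 (alpha (u f)'' + u f)]. With
     [u = v phi], [f = psi] on the left and [u = v], [f = psi phi] on the right, the product [u f]
     is the same, and [phi^3] accounts for the change in [u^3]. *)
  ring.
Qed.
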